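(* Let $m,s\in\mathbb N$, let $\mathcal F$ be an $m$-block Ferrers diagram of order $sm$ and let $d\in[sm]$ be such that $(\mathcal F,d)$ is MSRD-constructible. Let $D^B_{\max}:=\max_{i\in[s]}|D_i^B\cap\mathbf B(\mathcal F)|$. Then, for every prime power $q\ge D^B_{\max}+1$, the diagonal MSRD construction described in the context gives an $[\mathcal F,\nu_{\min}(\mathcal F,d),d]_q$ MFD code.
   Context: Notation: $\mathbb N=\{1,2,\dots\}$ and $[n]=\{1,\dots,n\}$, $[0]=\emptyset$. A (top-right justified) Ferrers diagram of order $n$ is a subset $\mathcal F\subseteq[n]^2$ such that (1) $(i,j)\in\mathcal F$ and $j<n$ imply $(i,j+1)\in\mathcal F$; (2) $(i,j)\in\mathcal F$ and $i>1$ imply $(i-1,j)\in\mathcal F$. Write $\mathcal F=[c_1,\dots,c_n]$ where $c_j$ is the number of elements of $\mathcal F$ in column $j$. For $d\in[n]$ and $j\in\{0,\dots,d-1\}$ let $\nu_j(\mathcal F,d)=\sum_{i=1}^{n-j}\max\{0,c_i-d+1+j\}$ and $\nu_{\min}(\mathcal F,d)=\min_{0\le j\le d-1}\nu_j(\mathcal F,d)$. Ferrers diagram codes: $\mathbb F_q^{\mathcal F}$ is the space of $n\times n$ matrices over $\mathbb F_q$ whose entries outside the positions in $\mathcal F$ are zero. An $[\mathcal F,k,d]_q$ code is a $k$-dimensional $\mathbb F_q$-linear subspace of $\mathbb F_q^{\mathcal F}$ whose minimum rank over nonzero elements is $d$ (the zero code is regarded as an $[\mathcal F,0,d]_q$ code).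 It is an MFD (maximum Ferrers diagram) code if $k=\nu_{\min}(\mathcal F,d)$. Blocks: $Q_{i,j}=Q_{i,j}^{(m)}:=([im]\setminus[(i-1)m])\times([jm]\setminus[(j-1)m])$. A Ferrers diagram $\mathcal F$ of order $sm$ is an $m$-block Ferrers diagram if $Q_{i,j}\cap\mathcal F\in\{\emptyset,Q_{i,j}\}$ for all $i,j\in[s]$. Its block set is $\mathbf B(\mathcal F)=\{Q_{i,j}: i,j\in[s],\ Q_{i,j}\subseteq\mathcal F\}$. The block diagonals are $D_i^B=\{Q_{l,s-i+l}:1\le l\le i\}$, $i\in[s]$. The pair $(\mathcal F,d)$ is MSRD-constructible if $\nu_{\min}(\mathcal F,d)=m\sum_{i=1}^s\max\{m|D_i^B\cap\mathbf B(\mathcal F)|-d+1,0\}$. MSRD codes: on $(\mathbb F_q^{m\times m})^t$ the sum-rank weight of $(X_1,\dots,X_t)$ is $\sum_i\operatorname{rk}(X_i)$. An $[(m\times m)^t,k,d]_q$ code is a $k$-dimensional $\mathbb F_q$-linear subspace whose minimum sum-rank weight over nonzero elements is $d$. It is MSRD if $k=m(tm-d+1)$. Diagonal MSRD construction: assume $q\ge D^B_{\max}+1$. For each $j\in\{\lceil d/m\rceil,\dots,D^B_{\max}\}$ let $A_j\subseteq(\mathbb F_q^{m\times m})^j$ be an $[(m\times m)^j,m(mj-d+1),d]_q$ MSRD code (such codes exist since $j\le q-1$), and let $A_j:=\{0\}$ for $j<\lceil d/m\rceil$. Define $\mathcal C$ as the set of all $C\in\mathbb F_q^{\mathcal F}$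 such that, for every $i\in[s]$, the $i$-th block diagonal of $C$ (the tuple of $m\times m$ submatrices of $C$ at the blocks in $D_i^B\cap\mathbf B(\mathcal F)$, ordered from top-left to bottom-right) is a codeword of $A_{|D_i^B\cap\mathbf B(\mathcal F)|}$.
   Formalization: The construction also requires all blocks strictly below the main block diagonal to be zero; without this the claim fails, e.g. for m=1, s=d=3, F=[1,3,3], where the matrix unit at (3,2) would be a codeword of rank 1. The condition is vacuous if F has no such blocks. *)

(* Defs.v *)
(* MathComp.  Row, column and block positions are 0-based ordinals; the block
   diagonals D^B_i keep the 1-based index i in {1, .., s}. *)
From mathcomp Require Import all_boot all_order all_algebra all_field.
Set Implicit Arguments.
Unset Strict Implicit.
Unset Printing Implicit Defensive.
Import GRing.Theory.
Local Open Scope ring_scope.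

Section FerrersDiagrams.
Local Open Scope nat_scope.
Variable n : nat.
Implicit Types (D : {set 'I_n * 'I_n}) (d : nat).

Definition ferrers D : Prop :=
  (forall i j j' : 'I_n, j' = j.+1 :> nat -> (i, j) \in D -> (i, j') \in D) /\
  (forall i i' j : 'I_n, i = i'.+1 :> nat -> (i, j) \in D -> (i', j) \in D).

Definition col_card D (j : 'I_n) : nat := #|[set i | (i, j) \in D]|.

(* Truncated subtraction plays the role of max{0, c_i - d + 1 + j}. *)
Definition nu D d (j : nat) : nat :=
  \sum_(i < n | i < n - j) (col_card D i + j.+1 - d).

(* The unit [nu D d 0] is itself one of the terms as soon as 0 < d. *)
Definition nu_min D d : nat := \big[minn/nu D d 0]_(j < d) nu D d j.

End FerrersDiagrams.

Section BlockDiagrams.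
Local Open Scope nat_scope.
Variables m s : nat.
Implicit Types (D : {set 'I_(s * m) * 'I_(s * m)}) (p : 'I_s * 'I_s).

Definition blockQ p : {set 'I_(s * m) * 'I_(s * m)} :=
  [set x : 'I_(s * m) * 'I_(s * m) |
    (p.1 * m <= x.1 < p.1.+1 * m) && (p.2 * m <= x.2 < p.2.+1 * m)].

Definition block_ferrers D : Prop :=
  ferrers D /\ forall p, blockQ p :&: D = set0 \/ blockQ p :&: D = blockQ p.

(* A block is represented by its position p (faithfully, when 0 < m). *)
Definition blocks D : {set 'I_s * 'I_s} := [set p | blockQ p \subset D].

(* 1-based (l, s - i + l) with 1 <= l <= i, for 1 <= i <= s. *)
Definition block_diag (i : nat) : {set 'I_s * 'I_s} :=
  [set p : 'I_s * 'I_s | p.2 + i == p.1 + s].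

Definition diag_blocks D (i : nat) : {set 'I_s * 'I_s} :=
  block_diag i :&: blocks D.

Definition max_diag D : nat := \max_(1 <= i < s.+1) #|diag_blocks D i|.

Definition msrd_constructible D (d : nat) : Prop :=
  nu_min D d = m * \sum_(1 <= i < s.+1) (m * #|diag_blocks D i| + 1 - d).

Lemma block_ord_subproof (a : 'I_s) (i : 'I_m) : a * m + i < s * m.
Proof.
apply: (@leq_trans (a.+1 * m)); first by rewrite mulSn addnC ltn_add2r.
by rewrite leq_mul2r ltn_ord orbT.
Qed.

Definition block_ord (a : 'I_s) (i : 'I_m) : 'I_(s * m) :=
  Ordinal (block_ord_subproof a i).

End BlockDiagrams.

Section Codes.
Variable F : finFieldType.

Definition has_min_weight (V : vectType F) (w : V -> nat) (C : {vspace V})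
    (d : nat) : Prop :=
  (forall x, x \in C -> x != 0 -> (d <= w x)%N) /\
  (exists x, [/\ x \in C, x != 0 & w x = d]).

Definition supported n (D : {set 'I_n * 'I_n}) (X : 'M[F]_n) : Prop :=
  forall i j, (i, j) \notin D -> X i j = 0.

Definition fd_code n (D : {set 'I_n * 'I_n}) (k d : nat)
    (C : {vspace 'M[F]_n}) : Prop :=
  [/\ forall X, X \in C -> supported D X,
      \dim C = k
    & C = 0%VS \/ has_min_weight (fun X : 'M[F]_n => \rank X) C d].

Definition mfd_code n (D : {set 'I_n * 'I_n}) (d : nat)
    (C : {vspace 'M[F]_n}) : Prop :=
  fd_code D (nu_min D d) d C.

Definition sum_rank m t (X : {ffun 'I_t -> 'M[F]_m}) : nat :=
  (\sum_(i < t) \rank (X i))%N.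

Definition sr_code m t (k d : nat)
    (C : {vspace {ffun 'I_t -> 'M[F]_m}}) : Prop :=
  \dim C = k /\ has_min_weight (@sum_rank m t) C d.

Definition msrd_code m t (d : nat)
    (C : {vspace {ffun 'I_t -> 'M[F]_m}}) : Prop :=
  sr_code (m * (t * m + 1 - d)) d C.

Definition ceil_div (d m : nat) : nat := ((d + m.-1) %/ m)%N.

(* The ingredients A_j of the diagonal construction; A_j is unconstrained, and
   never used, for j > max_diag D. *)
Definition diag_ingredients m s (D : {set 'I_(s * m) * 'I_(s * m)}) (d : nat)
    (A : forall j, {vspace {ffun 'I_j -> 'M[F]_m}}) : Prop :=
  (forall j, (ceil_div d m <= j <= max_diag D)%N -> msrd_code d (A j)) /\
  (forall j, (j < ceil_div d m)%N -> A j = 0%VS).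

Definition block_sub m s (X : 'M[F]_(s * m)) (p : 'I_s * 'I_s) : 'M[F]_m :=
  \matrix_(i, j) X (block_ord p.1 i) (block_ord p.2 j).

(* [enum_val] follows the lexicographic enumeration of 'I_s * 'I_s, so on a
   block diagonal it lists the blocks from top-left to bottom-right. *)
Definition diag_tuple m s (D : {set 'I_(s * m) * 'I_(s * m)})
    (X : 'M[F]_(s * m)) (i : nat) :
    {ffun 'I_#|diag_blocks D i| -> 'M[F]_m} :=
  [ffun k => block_sub X (enum_val k)].

(* Matrices obtained by writing codewords of the A_j on the block diagonals
   D^B_1, .., D^B_s and zeros elsewhere.  These diagonals only cover the block
   upper triangle, whereas D may contain blocks strictly below the main block
   diagonal: the second clause puts zeros there.  Without it the claim fails,
   e.g. for m = 1, s = d = 3 and D = [1, 3, 3], where the unit matrix at row 3,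
   column 2 would be a codeword of rank 1. *)
Definition diag_construction m s (D : {set 'I_(s * m) * 'I_(s * m)})
    (A : forall j, {vspace {ffun 'I_j -> 'M[F]_m}}) (X : 'M[F]_(s * m)) :
    Prop :=
  [/\ supported D X,
      forall p : 'I_s * 'I_s, (p.2 < p.1)%N -> block_sub X p = 0
    & forall i : nat, (1 <= i <= s)%N -> diag_tuple D X i \in A _].

End Codes.

(* Main.v *)
From HB Require Import structures.
Require Import Defs.
From mathcomp Require Import all_boot all_order all_algebra all_fingroup.
From mathcomp Require Import all_solvable all_field.
From mathcomp Require Import ring zify.

(** The ingredient codes are linearized Reed-Solomon codes.  Let L be the
    extension of F of degree m, sigma its Frobenius x |-> x ^ q, and a_1, .., a_t
    elements of L with pairwise distinct norms to F; powers of a generator of the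
    multiplicative group of L provide up to q - 1 of them.  A skew polynomial
    sum_l f_l X^l acts on L through the substitution X := (y |-> a sigma(y)), and
    the codewords are the tuples of these actions for a = a_1, .., a_t, the degree
    of f being less than k = tm - d + 1.  The total dimension of the kernels of
    the actions of a nonzero f is at most its degree (skew_kernel_bound): a
    nonzero y in the kernel at a_i lets one divide f on the right by X - c with
    c = a_i sigma(y) / y, and X - c has a kernel of dimension one at a_i and is
    injective at every other a_j because the norms differ.  Hence all nonzero
    codewords have weight at least tm - (k - 1) = d.  Weight exactly d is reached
    since any code of that dimension contains a nonzero word that vanishes on the
    last tm - d rows (the Singleton argument, sum_rank_light).

    For the Ferrers diagram code, writing one tuple on each block diagonal is a
    direct sum of injective linear maps, so that the dimension is the sum of the
    dimensions of the ingredients (dim_diag_code), which is nu_min exactly by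
    MSRD-constructibility.  For the rank, take the nonzero diagonal of a codeword
    that is closest to the main one: everything below it vanishes, hence the rank
    of the matrix is at least the sum of the ranks of the blocks on that diagonal
    (sum_rank_diag_le), which is the sum-rank weight of a nonzero word of an
    ingredient.  A minimum weight word of an ingredient alone on its diagonal
    has rank d. *)

Set Implicit Arguments.
Unset Strict Implicit.
Unset Printing Implicit Defensive.
Import GRing.Theory passmx.
Local Open Scope ring_scope.

(** * Finite fields: extensions and norm classes *)

(** L is the splitting field of X^n - X with n = q^m: this polynomial is
    separable, its derivative being -1, and its roots are the fixed points of a
    power of the Frobenius, hence form a subfield, hence are all of L. *)
Lemma finField_extension (F : finFieldType) (m : nat) : (0 < m)%N ->
  exists L : splittingFieldType F, \dim {:L} = m.
Proof.
move=> m_gt0; have q_gt1 := finNzRing_gt1 F; pose n := (#|F| ^ m)%N.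
have n_gt1 : (1 < n)%N by rewrite -(exp1n m) ltn_exp2r.
pose f (R : nzRingType) : {poly R} := 'X^n - 'X.
have size_f R : size (f R) = n.+1.
  by rewrite size_polyDl size_polyXn // size_polyN size_polyX ltnS.
have [/= L] : {L : splittingFieldType F |
    splittingFieldFor 1 (map_poly (in_alg L) (f F)) {:L}}.
  by apply: FinSplittingFieldFor; rewrite -size_poly_gt0 size_f.
rewrite [map_poly _ _]rmorphB rmorphXn /= map_polyX -/(f L) => -[zs f_zs gen_zs].
exists L; have [a _ Da] := finField_galois_generator (sub1v {:L}).
rewrite dimv1 expn1 in Da.
have root_f z : root (f L) z = (z \in fixedSpace (a ^+ m)%g).
  rewrite (sameP fixedSpaceP eqP) rootE !hornerE subr_eq0 /n; congr (_ == z).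
  elim: (m) => [|i IHi]; first by rewrite gal_id.
  by rewrite expgSr expnSr exprM IHi galM ?Da ?memvf.
have uniq_zs : uniq zs.
  have [p _ pcharF] := finPcharP F.
  have n0 : n%:R = 0 :> L.
    apply/eqP; rewrite -(@dvdn_pcharf _ p) ?pchar_lalg //.
    rewrite (dvdn_trans _ (dvdn_exp m_gt0 (dvdnn _))) //.
    have := card_pprimeChar pcharF; case: (logn p _) => [F1|k ->].
      by rewrite F1 in q_gt1.
    by rewrite expnS dvdn_mulr.
  rewrite -separable_prod_XsubC -(eqp_separable f_zs) unlock derivB derivXn derivX.
  rewrite -mulr_natr -polyC_natr n0 mulr0 sub0r -scaleN1r.
  by rewrite coprimepZr ?coprimep1 // oppr_eq0 oner_eq0.
have zs_full z : z \in zs.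
  rewrite -root_prod_XsubC -(eqp_root f_zs) root_f.
  suffices -> : fixedSpace (a ^+ m)%g = {:L}%VS by apply: memvf.
  apply/eqP; rewrite eqEsubv subvf -gen_zs -[fixedSpace _]subfield_closed agenvS //.
  rewrite subv_add sub1v; apply/span_subvP=> y y_zs.
  by rewrite -root_f (eqp_root f_zs) root_prod_XsubC.
apply: (expnI q_gt1); rewrite -/n.
rewrite -(card_vspace (fullv : {vspace finvect_type L})) card_vspacef.
apply: succn_inj; rewrite -(size_f L) (eqp_size f_zs) size_prod_XsubC.
rewrite -(card_uniqP (uniq_zs : uniq (zs : seq (finvect_type L)))).
by congr _.+1; apply: eq_card => z; rewrite zs_full.
Qed.

Lemma frobenius_lfun (F : finFieldType) (L : splittingFieldType F) :
  exists sigma : 'End(L), forall x, sigma x = x ^+ #|F|.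
Proof.
have [a _ Da] := finField_galois_generator (sub1v {:L}).
by exists a => x; rewrite Da ?memvf // dimv1 expn1.
Qed.

(** The hypothesis of the implication says that a i / a j = (y / x) ^ (q - 1), so
    that a i and a j have the same norm; the conclusion is that the norms of the
    a i are pairwise distinct.  This form is the one that the kernel bound uses. *)
Lemma distinct_norm_classes (F : finFieldType) (L : splittingFieldType F) (t : nat) :
  (t < #|F|)%N ->
  exists a : 'I_t -> L, (forall i, a i != 0) /\
   forall i j x y, x != 0 -> y != 0 ->
     a i * x ^+ #|F| * y = a j * y ^+ #|F| * x -> i = j.
Proof.
set q := #|F| => lt_tq.
pose Lf : finFieldType := FinFieldExtType L.
have q_gt1 : (1 < q)%N := finNzRing_gt1 F.
pose m := \dim {:L}.
have cardL : #|Lf| = (q ^ m)%N.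
  by rewrite -(card_vspace (fullv : {vspace finvect_type L})) card_vspacef.
(* Raising to the power N is the norm, and |L^*| = (q - 1) * N. *)
pose N := (\sum_(i < m) q ^ i)%N.
have DN : (q ^ m).-1 = (q.-1 * N)%N by rewrite predn_exp.
have N_gt0 : (0 < N)%N.
  have : (0 < (q ^ m).-1)%N.
    by rewrite -cardL -ltnS prednK ?finNzRing_gt1 // ltnW ?finNzRing_gt1.
  by rewrite DN muln_gt0 => /andP[].
have unity x : x != 0 :> L -> x ^+ (q.-1 * N)%N = 1.
  move=> nz; apply: (mulfI nz); rewrite -exprS -DN prednK ?expn_gt0 1?ltnW //.
  by rewrite mulr1 -cardL; apply: (expf_card (x : Lf)).
pose rs := [seq x <- enum Lf | x != 0].
have [w w_prim] : exists w : L, (q.-1 * N).-primitive_root w.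
  have : has (q.-1 * N).-primitive_root (rs : seq L).
    apply: has_prim_root.
    - by rewrite muln_gt0 N_gt0 andbT -ltnS prednK // ltnW.
    - apply/allP => x; rewrite mem_filter => /andP[/unity xN _].
      by rewrite unity_rootE xN.
    - by rewrite filter_uniq ?(enum_uniq Lf).
    - rewrite size_filter -DN -cardL -(cardC1 (0 : Lf)) cardE -size_filter.
      by rewrite enumT leqnn.
  by case/hasP => w _; exists w.
have w_n0 : w != 0.
  apply/eqP => w0; have /eqP := prim_expr_order w_prim.
  by rewrite w0 expr0n eqn0Ngt (prim_order_gt0 w_prim) eq_sym oner_eq0.
exists (fun i => w ^+ i); split=> [i|i j x y nx ny]; first by rewrite expf_neq0.
have Eq z : z ^+ q = z ^+ q.-1 * z by rewrite -exprSr prednK // ltnW.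
rewrite !Eq => e.
have {}e : w ^+ i * x ^+ q.-1 = w ^+ j * y ^+ q.-1.
  apply: (mulIf (mulf_neq0 nx ny)).
  by rewrite mulrA -[w ^+ i * _ * x]mulrA e -!mulrA [y * x]mulrC.
have /eqP := congr1 (fun z => z ^+ N) e.
rewrite !exprMn -!exprM !unity // !mulr1 (eq_prim_root_expr w_prim).
have lt_t k : (k < t -> k < q.-1)%N.
  by move=> /leq_trans; apply; rewrite -ltnS prednK // ltnW.
rewrite !modn_small ?ltn_pmul2r ?lt_t ?ltn_ord //.
by rewrite eqn_pmul2r // => /eqP/val_inj.
Qed.

(** * Kernels of skew polynomials *)

Section SkewEvaluation.

Variables (F : fieldType) (L : fieldExtType F) (sigma : 'End(L)).
Hypothesis sigmaM : {morph sigma : x y / x * y}.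
Hypothesis sigma_fixed : forall x y : L,
  x != 0 -> sigma y * x = sigma x * y -> y \in <[x]>%VS.

(** The operator substituted for the variable of a skew polynomial. *)
Definition twist (a : L) : 'End(L) := (amull a \o sigma)%VF.

(** Horner evaluation at the operator twist a of the skew polynomial with
    coefficient list s, constant coefficient first. *)
Fixpoint skew_eval (s : seq L) (a : L) : 'End(L) :=
  if s is x :: s' then (amull x + (skew_eval s' a \o twist a)%VF) else 0.

Lemma twistE a x : twist a x = a * sigma x.
Proof. by rewrite comp_lfunE lfunE. Qed.

Lemma skew_eval_cons x s a y :
  skew_eval (x :: s) a y = x * y + skew_eval s a (twist a y).
Proof. by rewrite /= add_lfunE lfunE comp_lfunE. Qed.

Lemma skew_eval_linear (I : Type) (r : seq I) (u v : I -> L) a (k : F) :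
  skew_eval [seq k *: u i + v i | i <- r] a =
    k *: skew_eval (map u r) a + skew_eval (map v r) a.
Proof.
elim: r => [|i r IHr] /=; first by rewrite scaler0 addr0.
by rewrite IHr linearP comp_lfunDl -comp_lfunZl scalerDr addrACA.
Qed.

(** Right division of s by X - c, with quotient g and remainder e.  Dividing the
    tail of s by X - sigma c is what makes a recursion on s possible, because
    X (X - c) = (X - sigma c) X after substitution; the last clause replaces
    the uniqueness of the division. *)
Lemma skew_division c s : exists g e,
  [/\ size g = (size s).-1,
      forall a y, skew_eval s a y = skew_eval g a (twist a y - c * y) + e * y
    & (e == 0) && all (pred1 0) g -> all (pred1 0) s].
Proof.
elim: s c => [|x s IHs] c.
  exists [::], 0; split=> // a y.
  by rewrite /= !zero_lfunE mul0r addr0.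
have [g [e [size_g gE g0]]] := IHs (sigma c).
have stepE a y : skew_eval (x :: s) a y =
    e * (twist a y - c * y)
      + skew_eval g a (twist a (twist a y - c * y)) + (x + e * c) * y.
  rewrite skew_eval_cons gE.
  have -> : twist a (twist a y) - sigma c * twist a y = twist a (twist a y - c * y).
    by rewrite linearB /= !twistE !sigmaM !mulrA; congr (_ - _ * _); rewrite mulrC.
  by rewrite mulrBr mulrDl mulrA; ring.
case: s IHs g0 size_g gE stepE => [|x' s] _ g0 size_g gE stepE.
  have g_nil : g = [::] by apply: size0nil.
  exists [::], x; split=> // a y.
  by rewrite /= add_lfunE comp_lfunE !zero_lfunE add0r addr0 lfunE.
exists (e :: g), (x + e * c); split=> [|a y|].
- by rewrite /= size_g.
- by rewrite stepE skew_eval_cons.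
rewrite [all _ (e :: g)]/= => /and3P[xe0 /= e0 g_0]; apply/andP; split; last first.
  by apply: g0; rewrite e0.
by move: xe0; rewrite (eqP e0) mul0r addr0.
Qed.

Lemma dim_lker_comp (f g : 'End(L)) :
  (\dim (lker (g \o f)%VF) <= \dim (lker g) + \dim (lker f))%N.
Proof.
rewrite -(limg_ker_dim f (lker (g \o f)%VF)) addnC leq_add //; last first.
  exact: dimvS (capvSr _ _).
apply/dimvS/subvP=> _ /memv_imgP[y + ->].
by rewrite !memv_ker comp_lfunE.
Qed.

(** Induction on the degree: when s has a root b at a i0, splitting off the factor
    X - c that vanishes there lowers the total kernel dimension by at most one,
    for X - c has kernel <[b]> at a i0 and is injective at the other a i. *)
Lemma skew_kernel_bound (I : finType) (a : I -> L) (s : seq L) :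
    (forall i, a i != 0) ->
    (forall i j x y, x != 0 -> y != 0 ->
       a i * sigma x * y = a j * sigma y * x -> i = j) ->
    ~~ all (pred1 0) s ->
  (\sum_i \dim (lker (skew_eval s (a i))) < size s)%N.
Proof.
move=> a_n0 a_sep; have [n] := ubnP (size s).
elim: n s => // n IHn s; rewrite ltnS => size_s s_n0.
have s_gt0 : (0 < size s)%N by case: (s) s_n0.
have [all0|] := boolP [forall i, lker (skew_eval s (a i)) == 0%VS].
  by rewrite big1 // => i _; rewrite (eqP (forallP all0 i)) dimv0.
rewrite negb_forall => /existsP[i0]; rewrite -vpick0.
set b := vpick _ => b_n0.
have b_ker : skew_eval s (a i0) b = 0 by apply/eqP; rewrite -memv_ker memv_pick.
(* The root b at a i0 is a root of X - c, which splits off on the right. *)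
pose c := a i0 * sigma b / b.
have [g [e [size_g gE g0]]] := skew_division c s.
have e0 : e = 0.
  move: b_ker; rewrite gE twistE divfK // subrr linear0 add0r => /eqP.
  by rewrite mulf_eq0 (negPf b_n0) orbF => /eqP.
have g_n0 : ~~ all (pred1 0) g.
  by apply: contra s_n0 => g_0; apply: g0; rewrite e0 eqxx.
have dim_le i : (\dim (lker (skew_eval s (a i))) <=
                 \dim (lker (skew_eval g (a i))) + (i == i0))%N.
  have -> : skew_eval s (a i) = (skew_eval g (a i) \o (twist (a i) - amull c))%VF.
    apply/lfunP=> y; rewrite gE e0 mul0r addr0 comp_lfunE.
    by rewrite add_lfunE opp_lfunE [amull c y]lfunE.
  apply: leq_trans (dim_lker_comp _ _) _; rewrite leq_add2l.
  have ker_c y : y \in lker (twist (a i) - amull c) ->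
      a i * sigma y * b = a i0 * sigma b * y.
    rewrite memv_ker add_lfunE opp_lfunE twistE [amull c y]lfunE /= subr_eq0.
    by move=> /eqP ->; rewrite /c mulrAC divfK.
  have [i_i0|ne_i] := eqVneq i i0.
    have -> : nat_of_bool true = \dim <[b]>%VS by rewrite dim_vline b_n0.
    apply/dimvS/subvP => y /ker_c y_eq; apply: sigma_fixed => //.
    by apply: (mulfI (a_n0 i0)); rewrite !mulrA -y_eq i_i0.
  rewrite leqn0 dimv_eq0 -subv0; apply/subvP=> y /ker_c y_eq.
  rewrite memv0; apply: contraNT ne_i => y_n0; apply/eqP.
  exact: a_sep y_n0 b_n0 y_eq.
have size_gs : (size g < size s)%N by rewrite size_g prednK.
apply: leq_ltn_trans (leq_sum _ (fun i _ => dim_le i)) _.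
have sum_i0 : (\sum_i (i == i0) = 1)%N.
  by rewrite (bigD1 i0) //= eqxx big1 // => i /negPf->.
rewrite big_split /= sum_i0 addn1 (leq_trans _ size_gs) // ltnS.
by apply: IHn => //; apply: leq_trans size_gs size_s.
Qed.

End SkewEvaluation.

(** * MSRD codes *)

(** Independent rows in the kernel of the matrix are the coordinates of independent
    elements of the kernel of f. *)
Lemma rank_mxof (F : fieldType) (V : vectType F) (e : (\dim {:V}).-tuple V)
    (f : 'End(V)) :
  basis_of {:V} e -> (\dim {:V} <= \rank (mxof e e f) + \dim (lker f))%N.
Proof.
move=> e_basis; set M := mxof e e f; pose K := row_base (kermx M).
pose X := [tuple vecof e (row i K) | i < \rank (kermx M)].
have X_free : free X.
  apply/freeP => k sum0 i.
  have : (\row_j k j) *m K = 0.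
    apply/eqP; rewrite -(vecof_eq0 e_basis) mulmx_sum_row linear_sum /=.
    apply/eqP; rewrite -[RHS]sum0; apply: eq_bigr => j _.
    by rewrite linearZ /= mxE -(tnth_nth 0 X j) tnth_mktuple.
  rewrite -(mul0mx _ K) => /(row_free_inj (row_base_free _)) /rowP/(_ i).
  by rewrite !mxE.
have X_ker : (<<X>> <= lker f)%VS.
  apply/span_subvP => _ /mapP[i _ ->]; rewrite memv_ker -(rVof_eq0 e_basis).
  rewrite -mul_mxof; have /sub_kermxP -> // : (row i K <= kermx M)%MS.
  by rewrite (submx_trans (row_sub _ _)) ?eq_row_base.
have := dimvS X_ker; rewrite (eqP X_free) size_tuple mxrank_ker.
by rewrite leq_subLR.
Qed.

(** Singleton bound: stack the t blocks and ask the rows from the d-th on to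
    vanish.  These are m * (t * m - d) linear conditions, and a matrix tuple with
    at most d nonzero rows has sum-rank at most d. *)
Lemma sum_rank_light (F : finFieldType) m t d (C : {vspace {ffun 'I_t -> 'M[F]_m}}) :
    (d <= t * m)%N -> (m * (t * m - d) < \dim C)%N ->
  exists x, [/\ x \in C, x != 0 & (sum_rank x <= d)%N].
Proof.
move=> d_le dimC; have m_gt0 : (0 < m)%N.
  have : (\dim C <= #|'I_t| * (m * m))%N.
    by apply: leq_trans (dimvS (subvf C)) _; rewrite dimvf.
  move: (\dim C) dimC => k; case: (posnP m) => // ->.
  by rewrite mul0n !muln0; case: k.
pose N := (t * m - d)%N.
have div_lt (r : 'I_N) : ((d + r) %/ m < t)%N.
  by rewrite ltn_divLR //; have := ltn_ord r; lia.
have mod_lt (r : 'I_N) : ((d + r) %% m < m)%N by rewrite ltn_mod.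
pose pi (X : {ffun 'I_t -> 'M[F]_m}) : 'M[F]_(N, m) :=
  \matrix_(r, c) X (Ordinal (div_lt r)) (Ordinal (mod_lt r)) c.
have pi_lin : linear pi.
  by move=> k X Y; apply/matrixP=> r c; rewrite !mxE !ffunE !mxE.
pose piL := GRing.isLinear.Build _ _ _ _ pi pi_lin.
pose pi' : {linear _ -> _} := HB.pack pi piL.
pose x := vpick (C :&: lker (linfun pi'))%VS.
have x_n0 : x != 0.
  rewrite vpick0 -dimv_eq0.
  have dim_im : (\dim (linfun pi' @: C)%VS <= m * N)%N.
    by apply: leq_trans (dimvS (subvf _)) _; rewrite dimvf dim_matrix mulnC.
  rewrite -lt0n -(ltn_add2r (\dim (linfun pi' @: C)%VS)) limg_ker_dim add0n.
  exact: leq_ltn_trans dim_im dimC.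
have /memv_capP[xC] : x \in (C :&: lker (linfun pi'))%VS by apply: memv_pick.
rewrite memv_ker lfunE /= => /eqP pi0; exists x; split=> //.
have rank_x i : (\rank (x i) <= minn m (d - i * m))%N.
  have -> : x i = pid_mx (minn m (d - i * m)) *m x i.
    apply/matrixP => r c; rewrite mxE (bigD1 r) //=.
    rewrite big1 ?addr0 => [|r' ne_r]; last first.
      by rewrite mxE -[_ == _ :> nat]/(r == r') eq_sym (negPf ne_r) mul0r.
    rewrite mxE eqxx /=; case: ltnP => [_|]; first by rewrite mul1r.
    rewrite mul0r => dr.
    have lt_r : (i * m + r < t * m)%N by apply: block_ord_subproof.
    have ltN : (i * m + r - d < N)%N by have := ltn_ord r; rewrite /N; lia.
    have /matrixP/(_ (Ordinal ltN) c) := pi0; rewrite !mxE => <-.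
    have e : (d + (i * m + r - d) = i * m + r)%N by have := ltn_ord r; lia.
    congr (x _ _ _); apply: val_inj => /=; rewrite e.
      by rewrite divnMDl // divn_small // addn0.
    by rewrite modnMDl modn_small.
  apply: leq_trans (mxrankM_maxl _ _) _.
  by rewrite rank_pid_mx // geq_minl.
apply: leq_trans (leq_sum _ (fun i _ => rank_x i)) _.
apply: leq_trans (geq_minr (t * m) d).
elim: (t) => [|u IHu] /=; first by rewrite big_ord0.
rewrite big_ord_recr /=; apply: leq_trans (leq_add IHu (leqnn _)) _.
by rewrite mulSn; lia.
Qed.

(** The codewords are the tuples of matrices, in a basis of the extension field, of
    the evaluations at a_1, .., a_t of one skew polynomial with k coefficients. *)
Lemma linearized_reed_solomon (F : finFieldType) m t d : (0 < m)%N -> (t < #|F|)%N ->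
    (1 <= d <= t * m)%N ->
  exists C : {vspace {ffun 'I_t -> 'M[F]_m}},
    \dim C = (m * (t * m + 1 - d))%N /\
    (forall x, x \in C -> x != 0 -> (d <= sum_rank x)%N).
Proof.
move=> m_gt0 lt_tq /andP[d_gt0 d_le].
have [L dimL] := finField_extension F m_gt0; subst m.
have [a [a_n0 a_sep]] := distinct_norm_classes L lt_tq.
have [sigma sigmaE] := frobenius_lfun L.
have sigmaM : {morph sigma : x y / x * y} by move=> x y; rewrite !sigmaE exprMn.
have sigma_fix (x y : L) : x != 0 -> sigma y * x = sigma x * y -> y \in <[x]>%VS.
  move=> x_n0 e.
  suff /vlineP[k yx] : y / x \in 1%VS.
    by apply/vlineP; exists k; rewrite -mulr_algl -yx divfK.
  rewrite (Fermat's_little_theorem 1%AS) dimv1 expn1.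
  rewrite expr_div_n -!sigmaE eqr_div //; first by rewrite e mulrC.
  by rewrite sigmaE expf_neq0.
pose n := \dim {:L}; pose k := (t * n + 1 - d)%N; pose e := vbasis {:L}.
pose coefs (c : {ffun 'I_k -> L}) := [seq c i | i <- enum 'I_k].
pose enc (c : {ffun 'I_k -> L}) : {ffun 'I_t -> 'M[F]_n} :=
  [ffun i => mxof e e (skew_eval sigma (coefs c) (a i))].
have enc_lin : linear enc.
  move=> x c c'; apply/ffunP=> i; rewrite !ffunE -linearP -skew_eval_linear.
  by congr (mxof e e (skew_eval _ _ _)); apply: eq_map => j; rewrite !ffunE.
pose encL := GRing.isLinear.Build _ _ _ _ enc enc_lin.
pose enc' : {linear _ -> _} := HB.pack enc encL.
have enc_weight c : c != 0 -> (d <= sum_rank (enc c))%N.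
  move=> c_n0; have coefs_n0 : ~~ all (pred1 0) (coefs c).
    apply: contra c_n0 => /allP c0; apply/eqP/ffunP => i; rewrite ffunE.
    by apply/eqP/c0/mapP; exists i; rewrite ?mem_enum.
  have ker_lt : (\sum_(i < t) \dim (lker (skew_eval sigma (coefs c) (a i))) < k)%N.
    have -> : k = size (coefs c) by rewrite size_map size_enum_ord.
    apply: (skew_kernel_bound sigmaM sigma_fix) => // i j x y.
    by rewrite !sigmaE; apply: a_sep.
  have : (\sum_(i < t) n <= sum_rank (enc c) +
     \sum_(i < t) \dim (lker (skew_eval sigma (coefs c) (a i))))%N.
    rewrite /sum_rank -big_split leq_sum //= => i _; rewrite ffunE.
    exact/rank_mxof/vbasisP.
  by rewrite sum_nat_const card_ord; move: ker_lt; rewrite /k; lia.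
have enc_inj : lker (linfun enc') == 0%VS.
  rewrite -subv0; apply/subvP => c; rewrite memv_ker memv0 lfunE /= => /eqP enc0.
  apply: contraTT d_gt0 => /enc_weight; rewrite enc0 /sum_rank big1 => [|i _].
    by rewrite leqn0 => /eqP->.
  by rewrite ffunE mxrank0.
exists (limg (linfun enc')); split.
  rewrite limg_dim_eq ?(eqP enc_inj) ?capv0 // dimvf.
  transitivity (#|'I_k| * dim L)%N; first by [].
  by rewrite card_ord -dimvf mulnC.
move=> _ /memv_imgP[c _ ->]; rewrite lfunE /= => enc_n0; apply: enc_weight.
by apply: contraNneq enc_n0 => ->; apply/eqP/(linear0 enc').
Qed.

Lemma msrd_code_exists (F : finFieldType) m t d : (0 < m)%N -> (t < #|F|)%N ->
  (1 <= d <= t * m)%N -> exists C : {vspace {ffun 'I_t -> 'M[F]_m}}, msrd_code d C.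
Proof.
move=> m_gt0 lt_tq d_range.
have [C [dimC wtC]] := linearized_reed_solomon m_gt0 lt_tq d_range.
exists C; split=> //; split=> //; case/andP: d_range => d_gt0 d_le.
have [|x [xC x_n0 x_le]] := @sum_rank_light F m t d C d_le.
  by rewrite dimC ltn_pmul2l //; lia.
by exists x; split=> //; apply/eqP; rewrite eqn_leq x_le wtC.
Qed.

(** * Block matrices *)

(** Adding the rows G p to those of the tail of r increases the rank by at least
    that of G p *m H p, because the rows of the tail all lie in the kernel
    of H p. *)
Lemma rank_sum_staircase (F : fieldType) (I : eqType) (r : seq I) k n
    (G : I -> 'M[F]_(k, n)) (H : I -> 'M[F]_(n, k)) :
    pairwise (fun p p' => G p' *m H p == 0) r ->
  (\sum_(p <- r) \rank (G p *m H p) <= \rank (\sum_(p <- r) <<G p>>)%MS)%N.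
Proof.
elim: r => [|p r IHr]; first by rewrite !big_nil.
rewrite pairwise_cons => /andP[/allP r_ker /IHr {}IHr]; rewrite !big_cons.
rewrite -(mxrank_mul_ker _ (H p)) leq_add //.
  by rewrite mxrankS // submxMr // (submx_trans _ (addsmxSl _ _)) ?genmxE.
apply: leq_trans IHr _; rewrite mxrankS // sub_capmx addsmxSr /=.
rewrite big_seq; elim/big_rec: _ => [|p' R p'_r R_ker]; first exact: sub0mx.
by rewrite addsmx_sub R_ker andbT genmxE sub_kermx r_ker.
Qed.

Section Blocks.

Variables (F : finFieldType) (m s : nat).
Implicit Types (X : 'M[F]_(s * m)) (p : 'I_s * 'I_s) (a b : 'I_s).

Lemma block_ord_inj a b (r r' : 'I_m) :
  block_ord a r = block_ord b r' -> a = b /\ r = r'.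
Proof.
have m_gt0 : (0 < m)%N by apply: leq_ltn_trans (ltn_ord r).
move=> /(congr1 val) /= e.
have ab : a = b.
  apply: val_inj; have := congr1 (divn^~ m) e.
  by rewrite !divnMDl // !divn_small // !addn0.
by split=> //; apply: val_inj; move: e; rewrite ab => /addnI.
Qed.

Lemma block_ord_surj (x : 'I_(s * m)) : exists a r, x = block_ord a r.
Proof.
have m_gt0 : (0 < m)%N by case: (posnP m) x => // ->; rewrite muln0 => -[].
have lt_div : (x %/ m < s)%N by rewrite ltn_divLR.
have lt_mod : (x %% m < m)%N by rewrite ltn_mod.
by exists (Ordinal lt_div), (Ordinal lt_mod); apply: val_inj; rewrite /= -divn_eq.
Qed.

(** The selector of the a-th group of m rows; its transpose selects columns. *)
Definition block_rows a : 'M[F]_(m, s * m) := rowsub (block_ord a) 1%:M.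

Lemma mul_block_rows k a (X : 'M[F]_(s * m, k)) :
  block_rows a *m X = rowsub (block_ord a) X.
Proof. by rewrite mul_rowsub_mx mul1mx. Qed.

Lemma block_rows_orth a b :
  block_rows a *m (block_rows b)^T = if a == b then 1%:M else 0.
Proof.
apply/matrixP=> r r'; rewrite mul_block_rows !mxE.
case: eqP => [/block_ord_inj[-> ->]|ne]; first by rewrite eqxx !mxE eqxx.
case: (eqVneq a b) => [ab|_]; last by rewrite mxE.
rewrite mxE; case: (eqVneq r r') => // rr'.
by case: ne; rewrite ab rr'.
Qed.

Lemma block_subE X p : block_sub X p = block_rows p.1 *m X *m (block_rows p.2)^T.
Proof.
rewrite mul_block_rows trmx_mxsub trmx1 mulmx_colsub mulmx1.
by apply/matrixP=> i j; rewrite !mxE.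
Qed.

Lemma block_subP X Y : (forall p, block_sub X p = block_sub Y p) -> X = Y.
Proof.
move=> eqXY; apply/matrixP=> x y.
have [a [r ->]] := block_ord_surj x; have [b [c ->]] := block_ord_surj y.
by have /matrixP/(_ r c) := eqXY (a, b); rewrite !mxE.
Qed.

(** The argument order lets the function of X carry a linear structure; diag_at
    below serves the same purpose. *)
Definition block_at p X := block_sub X p.
Fact block_at_linear p : linear (block_at p).
Proof. by move=> k X Y; apply/matrixP=> i j; rewrite !mxE. Qed.
HB.instance Definition _ p :=
  GRing.isLinear.Build F _ _ _ (block_at p) (block_at_linear p).

Definition block_embed p (B : 'M[F]_m) : 'M[F]_(s * m) :=
  (block_rows p.1)^T *m B *m block_rows p.2.

Lemma block_sub_embed p p' B :
  block_sub (block_embed p B) p' = if p == p' then B else 0.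
Proof.
rewrite block_subE /block_embed !mulmxA block_rows_orth -mulmxA block_rows_orth.
case: p p' => a b [a' b']; rewrite xpair_eqE /= [a' == a]eq_sym.
by case: eqP => _; case: eqP => _ //=; rewrite ?mul1mx ?mulmx1 ?mulmx0 ?mul0mx.
Qed.

Lemma rank_block_embed p B : (\rank (block_embed p B) <= \rank B)%N.
Proof. by rewrite (leq_trans (mxrankM_maxl _ _)) // mxrankM_maxr. Qed.

(** A matrix that vanishes below a block diagonal is block triangular with respect
    to it: sorted by rows, the blocks of r form a staircase. *)
Lemma sum_rank_diag_le X i (r : seq ('I_s * 'I_s)) :
    uniq r -> {in r, forall p, p.2 + i = p.1 + s}%N ->
    (forall p, (p.2 + i < p.1 + s)%N -> block_sub X p = 0) ->
  (\sum_(p <- r) \rank (block_sub X p) <= \rank X)%N.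
Proof.
move=> r_uniq r_diag X_tri.
pose lep (p p' : 'I_s * 'I_s) := (p.1 <= p'.1)%N.
rewrite -(perm_big _ (permEl (perm_sort lep r))) /=.
pose G p := block_rows p.1 *m X; pose H p := (block_rows p.2)^T.
under eq_bigr do rewrite block_subE -/(G _) -/(H _).
apply: leq_trans (rank_sum_staircase _) _; last first.
  apply: mxrankS; elim/big_rec: _ => [|p R _ R_X]; first exact: sub0mx.
  by rewrite addsmx_sub R_X andbT genmxE submxMl.
have : pairwise lep (sort lep r).
  rewrite -sorted_pairwise; first by apply: sort_sorted => p p'; apply: leq_total.
  by move=> p p' p''; apply: leq_trans.
have : uniq (sort lep r) by rewrite sort_uniq.
rewrite uniq_pairwise => ne_r le_r.
have : pairwise [rel p p' | (p != p') && lep p p'] (sort lep r).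
  by rewrite pairwise_relI ne_r.
apply: (@sub_in_pairwise _ (mem r)); last by apply/allP=> p; rewrite mem_sort.
move=> p p' /r_diag dp /r_diag dp' /= /andP[ne_p le_p].
apply/eqP; rewrite /G /H -(block_subE X (p'.1, p.2)); apply: X_tri => /=.
rewrite dp ltn_add2r ltn_neqAle; apply/andP; split; last exact: le_p.
apply: contraNneq ne_p => e.
rewrite [p]surjective_pairing [p']surjective_pairing xpair_eqE.
by rewrite -!val_eqE /= e eqxx /= -(eqn_add2r i) dp dp' e.
Qed.

Variable D : {set 'I_(s * m) * 'I_(s * m)}.

Lemma mem_blockQ p (r c : 'I_m) : (block_ord p.1 r, block_ord p.2 c) \in blockQ m p.
Proof. by rewrite inE /= !leq_addr !mulSn ![(m + _)%N]addnC !ltn_add2l !ltn_ord. Qed.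

Lemma block_supportedP X : block_ferrers D ->
  supported D X <-> forall p, p \notin blocks D -> block_sub X p = 0.
Proof.
move=> [_ D_block]; split=> [X_D p pD | X_D x y xyD].
  apply/matrixP=> r c; rewrite !mxE; apply: X_D; apply: contra pD => rcD.
  have [Q0|QQ] := D_block p.
    have := in_set0 (block_ord p.1 r, block_ord p.2 c).
    by rewrite -Q0 inE mem_blockQ rcD.
  by rewrite inE -QQ subsetIr.
have [a [r ex]] := block_ord_surj x; have [b [c ey]] := block_ord_surj y; subst x y.
have -> : X (block_ord a r) (block_ord b c) = block_sub X (a, b) r c by rewrite mxE.
rewrite X_D ?mxE //; apply: contra xyD; rewrite inE => /subsetP; apply.
exact: (mem_blockQ (a, b)).
Qed.

Definition diag_embed i (Y : {ffun 'I_#|diag_blocks D i| -> 'M[F]_m}) :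
    'M[F]_(s * m) :=
  \sum_k block_embed (enum_val k) (Y k).

Fact diag_embed_linear i : linear (@diag_embed i).
Proof.
move=> k Y Z; rewrite scaler_sumr -big_split; apply: eq_bigr => j _ /=.
by rewrite /block_embed !ffunE mulmxDr mulmxDl -scalemxAr -scalemxAl.
Qed.
HB.instance Definition _ i :=
  GRing.isLinear.Build F _ _ _ (@diag_embed i) (@diag_embed_linear i).

Lemma block_sub_diag_embed i Y k :
  block_sub (@diag_embed i Y) (enum_val k) = Y k.
Proof.
rewrite -/(block_at _ _) linear_sum (bigD1 k) //= big1 => [|j ne_j].
  by rewrite /block_at block_sub_embed eqxx addr0.
by rewrite /block_at block_sub_embed (inj_eq enum_val_inj) (negPf ne_j).
Qed.

Lemma block_sub_diag_embed_out i Y p :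
  p \notin diag_blocks D i -> block_sub (@diag_embed i Y) p = 0.
Proof.
move=> pDi; rewrite -/(block_at _ _) linear_sum big1 //= => j _.
rewrite /block_at block_sub_embed; case: eqP => // e.
by move: pDi; rewrite -e enum_valP.
Qed.

Lemma diag_blocks_disjoint i j p :
  p \in diag_blocks D i -> p \in diag_blocks D j -> i = j.
Proof.
rewrite !inE => /andP[/eqP ei _] /andP[/eqP ej _].
by apply: (@addnI p.2); rewrite ei ej.
Qed.

Lemma diag_embedK i : cancel (@diag_embed i) (fun X => diag_tuple D X i).
Proof. by move=> Y; apply/ffunP=> k; rewrite ffunE block_sub_diag_embed. Qed.

Lemma diag_tuple_embed_ne i j Y : i <> j -> diag_tuple D (@diag_embed i Y) j = 0.
Proof.
move=> ne_ij; apply/ffunP=> k; rewrite !ffunE block_sub_diag_embed_out //.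
apply/negP => /diag_blocks_disjoint/(_ (enum_valP k)); exact: ne_ij.
Qed.

Definition diag_at i X := diag_tuple D X i.
Fact diag_at_linear i : linear (diag_at i).
Proof.
move=> k X Y; apply/ffunP=> j; rewrite !ffunE.
exact: (linearP (block_at _)).
Qed.
HB.instance Definition _ i :=
  GRing.isLinear.Build F _ _ _ (diag_at i) (diag_at_linear i).

Lemma block_sub_embed_tuple i X p :
  block_sub (diag_embed (diag_tuple D X i)) p =
    if p \in diag_blocks D i then block_sub X p else 0.
Proof.
case: ifPn => [pDi|]; last exact: block_sub_diag_embed_out.
by rewrite -(enum_rankK_in pDi pDi) block_sub_diag_embed ffunE.
Qed.

Lemma rank_diag_embed i Y : (\rank (@diag_embed i Y) <= sum_rank Y)%N.
Proof.
rewrite /diag_embed /sum_rank; elim/big_ind2: _ => [|A k B l Ak Bl|k _].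
- by rewrite mxrank0.
- by rewrite (leq_trans (mxrank_add _ _)) // leq_add.
- exact: rank_block_embed.
Qed.

(** The diagonals above the i-th one cannot cancel the rank that it contributes. *)
Lemma sum_rank_diag_tuple i X :
    (forall p, (p.2 + i < p.1 + s)%N -> block_sub X p = 0) ->
  (sum_rank (diag_tuple D X i) <= \rank X)%N.
Proof.
move=> X_tri; rewrite /sum_rank.
have -> : (\sum_k \rank (diag_tuple D X i k) =
           \sum_(p <- enum (diag_blocks D i)) \rank (block_sub X p))%N.
  by rewrite big_enum [RHS]big_enum_val; apply: eq_bigr => k _; rewrite ffunE.
apply: (@sum_rank_diag_le X i) => //; first exact: enum_uniq.
by move=> p; rewrite mem_enum !inE => /andP[/eqP].
Qed.

(** The diagonal construction as a subspace; its members are characterized in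
    diag_code_construction. *)
Definition diag_code (A : forall j, {vspace {ffun 'I_j -> 'M[F]_m}}) :
    {vspace 'M[F]_(s * m)} :=
  (\sum_(i < s) linfun (@diag_embed i.+1) @: A _)%VS.

Lemma diag_construction_decomp (A : forall j, {vspace {ffun 'I_j -> 'M[F]_m}}) X :
    block_ferrers D -> diag_construction D A X ->
  X = \sum_(i < s) diag_embed (diag_tuple D X i.+1).
Proof.
move=> D_block [X_D X_low _]; apply: block_subP => p.
rewrite -[RHS]/(block_at p _) linear_sum.
have -> : \sum_(i < s) block_at p (diag_embed (diag_tuple D X i.+1)) =
    \sum_(i < s) if p \in diag_blocks D i.+1 then block_sub X p else 0.
  by apply: eq_bigr => i _; apply: block_sub_embed_tuple.
have [pD|pD] := boolP (p \in blocks D); last first.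
  rewrite (block_supportedP X D_block).1 // big1 // => i _.
  by rewrite inE (negPf pD) andbF.
have [lt_p|le_p] := ltnP p.2 p.1.
  by rewrite X_low // big1 // => i _; rewrite if_same.
(* The diagonal of p has 1-based index p.1 + s - p.2. *)
have lt_i0 : ((p.1 + s - p.2).-1 < s)%N.
  by have := ltn_ord p.1; have := ltn_ord p.2; lia.
rewrite (bigD1 (Ordinal lt_i0)) //= big1 => [|i ne_i].
  rewrite inE pD andbT inE ifT ?addr0 //.
  by have := ltn_ord p.1; have := ltn_ord p.2; lia.
rewrite ifF //; apply: contraNF ne_i; rewrite inE => /andP[+ _]; rewrite inE => e.
by apply/eqP/val_inj => /=; have := ltn_ord p.1; have := ltn_ord p.2; lia.
Qed.

Lemma diag_code_construction (A : forall j, {vspace {ffun 'I_j -> 'M[F]_m}}) X :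
  block_ferrers D -> X \in diag_code A <-> diag_construction D A X.
Proof.
move=> D_block; split=> [/memv_sumP[v v_A ->]|XD].
  have {v_A} [Y YA vY] : exists2
      Y : forall i : 'I_s, {ffun 'I_#|diag_blocks D i.+1| -> 'M[F]_m},
      forall i, Y i \in A _ & forall i, v i = diag_embed (Y i).
    have /fin_all_exists2[Y] : forall i : 'I_s,
        exists2 Y, Y \in A #|diag_blocks D i.+1| & v i = diag_embed Y.
      by move=> i; have /memv_imgP[Y YA ->] := v_A i isT; exists Y; rewrite ?lfunE.
    by exists Y.
  rewrite (eq_bigr _ (fun i _ => vY i)).
  split.
  - apply/block_supportedP => // p pD.
    rewrite -/(block_at p _) linear_sum big1 // => i _.
    by apply: block_sub_diag_embed_out; rewrite inE (negPf pD) andbF.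
  - move=> p lt_p; rewrite -/(block_at p _) linear_sum big1 // => i _.
    apply: block_sub_diag_embed_out; rewrite inE negb_and inE.
    by apply/orP; left; have := ltn_ord i; lia.
  - case=> // i lt_i.
    rewrite -/(diag_at i.+1 _) linear_sum (bigD1 (Ordinal lt_i)) //=.
    rewrite big1 => [|j ne_j]; last first.
      apply: diag_tuple_embed_ne => -[e]; case/negP: ne_j.
      exact/eqP/val_inj.
    by rewrite addr0 /diag_at diag_embedK; apply: (YA (Ordinal lt_i)).
rewrite (diag_construction_decomp D_block XD); apply: memv_sumr => i _.
have [_ _ /(_ i.+1 (ltn_ord i)) XA] := XD.
by rewrite -[diag_embed _]lfunE memv_img.
Qed.

Lemma dim_diag_code (A : forall j, {vspace {ffun 'I_j -> 'M[F]_m}}) :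
  \dim (diag_code A) = (\sum_(i < s) \dim (A #|diag_blocks D i.+1|))%N.
Proof.
rewrite (directvP _); last first.
  apply/directv_sum_independent => v v_A sum0 i _.
  have /memv_imgP[Y _ viE] := v_A i isT.
  have : diag_at i.+1 (\sum_(j < s) v j) = Y.
    rewrite linear_sum (bigD1 i) //= big1 => [|j ne_j].
      by rewrite viE lfunE addr0; apply: diag_embedK.
    have /memv_imgP[Z _ ->] := v_A j isT; rewrite lfunE.
    by apply: diag_tuple_embed_ne => -[e]; case/negP: ne_j; apply/eqP/val_inj.
  by rewrite sum0 linear0 viE => <-; rewrite linear0.
apply: eq_bigr => i _; apply: limg_dim_eq; apply/eqP; rewrite -subv0.
apply/subvP => Y; rewrite memv_cap memv_ker lfunE memv0 => /andP[_ /eqP Y0].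
by rewrite -[Y](diag_embedK) /= Y0; apply/eqP; apply: (linear0 (diag_at _)).
Qed.

End Blocks.

(** * The diagonal construction *)

Lemma ltn_ceil_div d m j : (0 < m -> (j < ceil_div d m) = (j * m < d))%N.
Proof.
move=> m_gt0; rewrite /ceil_div leq_divRL // mulSn; apply/idP/idP; lia.
Qed.

Section DiagonalCodes.

Variables (F : finFieldType) (m s d : nat) (D : {set 'I_(s * m) * 'I_(s * m)}).
Hypotheses (m_gt0 : (0 < m)%N) (d_gt0 : (0 < d)%N).

Lemma card_diag_blocks_le i : (i < s)%N -> (#|diag_blocks D i.+1| <= max_diag D)%N.
Proof.
move=> lt_i; rewrite /max_diag big_add1 big_mkord.
exact: (@leq_bigmax _ (fun j : 'I_s => #|diag_blocks D j.+1|) (Ordinal lt_i)).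
Qed.

(** Only the finitely many lengths up to max_diag D matter, so that the codes can
    be chosen by finite choice and extended by zero. *)
Lemma diag_ingredients_exist : (max_diag D + 1 <= #|F|)%N ->
  exists A : forall j, {vspace {ffun 'I_j -> 'M[F]_m}}, diag_ingredients D d A.
Proof.
rewrite addn1 => q_large; set n := max_diag D.
have /fin_all_exists[f fP] : forall j : 'I_n.+1,
    exists C : {vspace {ffun 'I_j -> 'M[F]_m}},
      if (ceil_div d m <= j)%N then msrd_code d C else C = 0%VS.
  move=> j; case: (boolP (ceil_div d m <= j)%N) => [|_]; last by exists 0%VS.
  rewrite leqNgt ltn_ceil_div // -leqNgt => le_dj.
  by apply: msrd_code_exists; rewrite ?d_gt0 // (leq_ltn_trans _ q_large) // -ltnS.
exists (fun j =>
  if @idP (j < n.+1)%N is ReflectT lt_jn then f (Ordinal lt_jn) else 0%VS).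
split=> j.
  case: {-}_ / idP => [lt_jn|ge_jn] /andP[le_dj le_jn]; last by case: ge_jn.
  by have := fP (Ordinal lt_jn); rewrite /= le_dj.
case: {-}_ / idP => // lt_jn; rewrite ltnNge => /negPf lt_jd.
by have := fP (Ordinal lt_jn); rewrite /= lt_jd.
Qed.

Hypothesis D_block : block_ferrers D.
Variable A : forall j, {vspace {ffun 'I_j -> 'M[F]_m}}.
Hypothesis A_msrd : diag_ingredients D d A.

Lemma ingredient_msrd i Y : (i < s)%N -> Y \in A #|diag_blocks D i.+1| -> Y != 0 ->
  msrd_code d (A #|diag_blocks D i.+1|).
Proof.
move=> lt_i YA Y_n0; apply: (A_msrd.1); rewrite card_diag_blocks_le // andbT leqNgt.
by apply: contra Y_n0 => /(A_msrd.2) A0; move: YA; rewrite A0 memv0.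
Qed.

(** Below the threshold ceil_div d m, where the ingredient is zero, the truncated
    subtraction vanishes as well. *)
Lemma dim_ingredient i : (i < s)%N ->
  \dim (A #|diag_blocks D i.+1|) = (m * (m * #|diag_blocks D i.+1| + 1 - d))%N.
Proof.
move=> lt_i; case: (ltnP #|diag_blocks D i.+1| (ceil_div d m)) => [lt_d|le_d].
  rewrite (A_msrd.2 _ lt_d) dimv0; move: lt_d; rewrite ltn_ceil_div // mulnC => lt_d.
  by symmetry; apply/eqP; rewrite muln_eq0; apply/orP; right; lia.
have [|-> _] := A_msrd.1 #|diag_blocks D i.+1|; last by rewrite [(m * #|_|)%N]mulnC.
by rewrite le_d card_diag_blocks_le.
Qed.

Lemma diag_tuple_neq0 X : X \in diag_code D A -> X != 0 ->
  exists i : 'I_s, diag_tuple D X i.+1 != 0.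
Proof.
move=> /(diag_code_construction _ _ D_block) XC X_n0; apply/existsP.
apply: contraNT X_n0; rewrite negb_exists => /forallP X0; apply/eqP.
rewrite (diag_construction_decomp D_block XC) big1 // => i _.
by have := X0 i; rewrite negbK => /eqP ->; apply: linear0.
Qed.

(** The rank is already large on the nonzero diagonal closest to the main one, below
    which the matrix vanishes. *)
Lemma rank_diag_code X : X \in diag_code D A -> X != 0 -> (d <= \rank X)%N.
Proof.
move=> XC X_n0; have [X_D X_low X_A] := (diag_code_construction _ _ D_block).1 XC.
have [i0 Xi0] := diag_tuple_neq0 XC X_n0.
pose nonzero (i : 'I_s) := diag_tuple D X i.+1 != 0.
case: (@arg_maxnP _ i0 nonzero val Xi0) => i Xi i_max.
have Xi_A := X_A i.+1 (ltn_ord i).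
have [_ [wt_A _]] := ingredient_msrd (ltn_ord i) Xi_A Xi.
apply: leq_trans (wt_A _ Xi_A Xi) _; apply: sum_rank_diag_tuple => p lt_p.
have [/X_low //|le_p] := ltnP p.2 p.1.
have [pD|] := boolP (p \in blocks D); last exact: (block_supportedP X D_block).1.
have lt_j : ((p.1 + s - p.2).-1 < s)%N.
  by have := ltn_ord p.1; have := ltn_ord p.2; lia.
have pDj : p \in diag_blocks D (p.1 + s - p.2).-1.+1.
  by rewrite inE pD andbT inE; have := ltn_ord p.1; have := ltn_ord p.2; lia.
have := block_sub_embed_tuple D (p.1 + s - p.2).-1.+1 X p; rewrite pDj => <-.
have [->|Xj] := eqVneq (diag_tuple D X (p.1 + s - p.2).-1.+1) 0.
  by rewrite linear0; apply: (linear0 (block_at p)).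
have /= := i_max (Ordinal lt_j) Xj.
by have := ltn_ord p.1; have := ltn_ord p.2; lia.
Qed.

Lemma diag_code_min_rank : diag_code D A = 0%VS \/
  has_min_weight (fun X : 'M[F]_(s * m) => \rank X) (diag_code D A) d.
Proof.
have [->|C_n0] := eqVneq (diag_code D A) 0%VS; [by left | right].
split; first exact: rank_diag_code.
have [i Xi] := diag_tuple_neq0 (memv_pick _) (etrans (congr1 negb (vpick0 _)) C_n0).
have [_ _ /(_ i.+1 (ltn_ord i)) Xi_A] :=
  (diag_code_construction _ _ D_block).1 (memv_pick (diag_code D A)).
have [_ [_ [Y [YA Y_n0 wtY]]]] := ingredient_msrd (ltn_ord i) Xi_A Xi.
have XC : diag_embed Y \in diag_code D A.
  by apply/(@sumv_sup _ _ _ i) => //; rewrite -[diag_embed Y]lfunE; apply: memv_img.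
have X_n0 : diag_embed Y != 0.
  apply: contraNneq Y_n0 => X0; rewrite -[Y]diag_embedK X0.
  by apply/eqP/(linear0 (diag_at D _)).
exists (diag_embed Y); split=> //; apply/eqP.
rewrite eqn_leq rank_diag_code // andbT.
by rewrite -wtY rank_diag_embed.
Qed.

End DiagonalCodes.

Local Close Scope ring_scope.

Theorem theorem3p8 (m s : nat) (D : {set 'I_(s * m) * 'I_(s * m)}) (d : nat)
    (m_gt0 : 0 < m) (s_gt0 : 0 < s) (D_ferrers : block_ferrers D)
    (d_range : 1 <= d <= s * m) (D_constr : msrd_constructible D d)
    (F : finFieldType) (q_large : max_diag D + 1 <= #|F|) :
  (exists A : forall j, {vspace {ffun 'I_j -> 'M[F]_m}},
      diag_ingredients D d A) /\
  (forall A : forall j, {vspace {ffun 'I_j -> 'M[F]_m}},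
      diag_ingredients D d A ->
      exists2 C : {vspace 'M[F]_(s * m)},
        (forall X, X \in C <-> diag_construction D A X) & mfd_code D d C).
Proof.
have d_gt0 : 0 < d by case/andP: d_range.
split=> [|A A_msrd]; first exact: diag_ingredients_exist.
exists (diag_code D A) => [X|]; first exact: diag_code_construction.
split.
- by move=> X /(diag_code_construction _ _ D_ferrers)[].
- rewrite dim_diag_code D_constr big_add1 big_mkord big_distrr /=.
  by apply: eq_bigr => i _; apply: dim_ingredient.
- exact: diag_code_min_rank.
Qed.
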